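(* Let $K$ be a field, let $t\ge 1$ be an integer, and let $u\in S=K[x_1,\dots,x_n]$ be a $t$-spread monomial. Then the toric algebra $K[B_t(u)]$ is Koszul.
   Context: A monomial $x_{i_1}x_{i_2}\cdots x_{i_d}$ with $i_1\le i_2\le\cdots\le i_d$ is called $t$-spread if $i_j-i_{j-1}\ge t$ for $2\le j\le d$. A $t$-spread monomial ideal is an ideal generated by $t$-spread monomials. For a monomial $w$, $\operatorname{supp}(w)=\{j : x_j \text{ divides } w\}$. A $t$-spread monomial ideal $I$ is called $t$-spread strongly stable if for all $t$-spread monomials $w\in I$, all $j\in\operatorname{supp}(w)$ and all $i<j$ such that $x_i(w/x_j)$ is $t$-spread, one has $x_i(w/x_j)\in I$. $B_t(u)$ is the unique smallest $t$-spread strongly stable ideal of $S$ containing $u$, and $G(B_t(u))$ is its minimal set of monomial generators (all of degree $\deg u$). $K[B_t(u)]$ is the $K$-subalgebra of $S$ generated by the monomials $v\in G(B_t(u))$, standard graded so that each generator $v$ has degree $1$. *)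

(* Defs.v *)
From HB Require Import structures.
From mathcomp Require Import all_boot all_order all_algebra.
From mathcomp Require Export mpoly.

Set Implicit Arguments.
Unset Strict Implicit.
Unset Printing Implicit Defensive.

Import GRing.Theory.
Local Open Scope ring_scope.

(* Ideals and subalgebras below are Prop-valued predicates, since membership  *)
(* in an ideal or a subalgebra given by generators is not decidable a priori. *)

Definition is_ideal (A : comNzRingType) (I : A -> Prop) : Prop :=
  [/\ I 0,
      forall x y, I x -> I y -> I (x + y)
    & forall a x, I x -> I (a * x)].

Definition ideal_gen (A : comNzRingType) (G : A -> Prop) (x : A) : Prop :=
  forall I : A -> Prop, is_ideal I -> (forall g, G g -> I g) -> I x.

Definition is_subalg (K : fieldType) (A : algType K) (R : A -> Prop) : Prop :=
  [/\ R 1,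
      forall (a : K) x y, R x -> R y -> R (a *: x + y)
    & forall x y, R x -> R y -> R (x * y)].

Definition subalg_gen (K : fieldType) (A : algType K) (G : A -> Prop) (x : A) :
    Prop :=
  forall R : A -> Prop, is_subalg R -> (forall g, G g -> R g) -> R x.

(* [s] lists i_1, ..., i_d; the relation forces i_1 <= ... <= i_d as well. *)
Definition t_spread (n t : nat) (m : 'X_{1..n}) : Prop :=
  exists2 s : seq 'I_n, sorted (fun i j : 'I_n => (i + t <= j)%N) s
                      & m = (\sum_(i <- s) U_(i))%MM.

Definition t_spread_ideal (K : fieldType) (n t : nat)
    (I : {mpoly K[n]} -> Prop) : Prop :=
  exists2 G : 'X_{1..n} -> Prop, forall m, G m -> t_spread t m
    & forall p, I p <-> ideal_gen (fun q => exists2 m, G m & q = 'X_[m]) p.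

Definition t_spread_strongly_stable (K : fieldType) (n t : nat)
    (I : {mpoly K[n]} -> Prop) : Prop :=
  t_spread_ideal t I /\
  forall (w : 'X_{1..n}) (j i : 'I_n),
    t_spread t w -> I 'X_[w] -> w j != 0%N -> (i < j)%N ->
    t_spread t (w - U_(j) + U_(i))%MM -> I 'X_[(w - U_(j) + U_(i))%MM].

(* B_t(u). The intersection of all t-spread strongly stable ideals containing *)
(* u is itself one of them when u is t-spread and t >= 1: see [Bt_smallest].  *)
Definition Bt (K : fieldType) (n t : nat) (u : 'X_{1..n}) (p : {mpoly K[n]}) :
    Prop :=
  forall I : {mpoly K[n]} -> Prop,
    t_spread_strongly_stable t I -> I 'X_[u] -> I p.

Definition min_monomial_gen (K : fieldType) (n : nat)
    (I : {mpoly K[n]} -> Prop) (m : 'X_{1..n}) : Prop :=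
  I 'X_[m] /\ forall m' : 'X_{1..n}, I 'X_[m'] -> (m' <= m)%MM -> m' = m.

Definition toric (K : fieldType) (n t : nat) (u : 'X_{1..n}) :
    {mpoly K[n]} -> Prop :=
  subalg_gen (fun q => exists2 v, min_monomial_gen (@Bt K n t u) v
                                & q = 'X_[v]).

(* The degree in K[B_t(u)] is the degree in S divided by deg u, because all   *)
(* elements of G(B_t(u)) have degree deg u: see [min_monomial_gen_Bt_mdeg].   *)
(* For u = 1 the algebra is K, and [maxn 1] puts it in degree 0.              *)
Definition toric_gr (K : fieldType) (n t : nat) (u : 'X_{1..n}) (k : nat)
    (p : {mpoly K[n]}) : Prop :=
  toric t u p /\ p \is (k * maxn 1 (mdeg u)).-homog.

Definition irrelevant (A : comNzRingType) (gr : nat -> A -> Prop) (x : A) :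
    Prop :=
  exists N (f : nat -> A), (forall k, gr k.+1 (f k)) /\ x = \sum_(k < N) f k.

Definition mx_over (A : comNzRingType) (R : A -> Prop) (m n : nat)
    (M : 'M[A]_(m, n)) : Prop :=
  forall i j, R (M i j).

(* R is a graded subring of A, with components gr k and with R_0 = K.  It is  *)
(* Koszul when the residue field K = R / R_+ has a linear free R-resolution   *)
(*   ... -> R(-2)^(b 2) -> R(-1)^(b 1) -> R^(b 0) = R -> K -> 0.              *)
(* The elements of R^b are the row vectors with entries in R, and the i-th    *)
(* differential is v |-> v *m d i; as a map R(-i-1)^(b i.+1) -> R(-i)^(b i)   *)
(* it is homogeneous of degree 0 iff the entries of d i lie in R_1.           *)
Definition koszul (A : comNzRingType) (R : A -> Prop) (gr : nat -> A -> Prop) :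
    Prop :=
  exists (b : nat -> nat) (d : forall i, 'M[A]_(b i.+1, b i)),
    [/\ b 0 = 1%N,
        forall i, mx_over (gr 1%N) (d i),
        forall v : 'rV[A]_(b 0), mx_over R v ->
          (mx_over (irrelevant gr) v <->
           exists2 w : 'rV[A]_(b 1), mx_over R w & v = w *m d 0)
      & forall i (v : 'rV[A]_(b i.+1)), mx_over R v ->
          (v *m d i = 0 <->
           exists2 w : 'rV[A]_(b i.+2), mx_over R w & v = w *m d i.+1)].

Lemma ideal_gen_is_ideal (A : comNzRingType) (G : A -> Prop) :
  is_ideal (ideal_gen G).
Proof.
split=> [I [] //|x y hx hy I hI hG|a x hx I hI hG].
  by case: (hI) => _ + _; apply; [apply: hx | apply: hy].
by case: (hI) => _ _; apply; apply: hx.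
Qed.

Lemma monomial_idealP (K : fieldType) (n : nat) (G : 'X_{1..n} -> Prop)
    (p : {mpoly K[n]}) :
  ideal_gen (fun q => exists2 m, G m & q = 'X_[m]) p <->
  forall m, m \in msupp p -> exists2 v, G v & (v <= m)%MM.
Proof.
split=> [|hp I [I0 ID IM] hG].
  move=> hp; apply: (hp (fun p : {mpoly K[n]} => forall m, m \in msupp p ->
    exists2 v, G v & (v <= m)%MM)) => {hp} [|_ [v Gv ->] m]; last first.
    by rewrite msuppX inE => /eqP ->; exists v; rewrite ?lepm_refl.
  split=> [m|x y hx hy m /msuppD_le|a x hx m /msuppM_le].
  - by rewrite msupp0.
  - by rewrite mem_cat => /orP[/hx|/hy].
  - case/allpairsP=> -[m1 m2] /= [_ /hx [v Gv le_v] ->]; exists v => //.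
    by apply: lepm_trans le_v _; apply: lem_addl; rewrite lepm_refl.
rewrite (mpolyE p) big_seq; elim/big_ind: _ => // m /hp [v Gv le_v].
by rewrite -mul_mpolyC -(submK le_v) mpolyXD; do 2!apply: (IM); apply: hG; exists v.
Qed.

Lemma t_spread_dvd (n t : nat) (v m : 'X_{1..n}) :
  (1 <= t)%N -> t_spread t m -> (v <= m)%MM -> t_spread t v.
Proof.
move=> t1 [s s_sorted ->] /mnm_lepP le_v.
have tr : transitive (fun i j : 'I_n => (i + t <= j)%N).
  by move=> j i k h1; apply: leq_trans; apply: leq_trans h1 _; apply: leq_addr.
have irr : irreflexive (fun i j : 'I_n => (i + t <= j)%N).
  by move=> i; rewrite -{2}[i : nat]addn0 leq_add2l leqNgt t1.
have s_uniq := sorted_uniq tr irr s_sorted.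
exists [seq i <- s | v i != 0%N]; first exact: sorted_filter.
apply/mnmP=> i; move: (le_v i); rewrite !mnm_sumE.
have cnt (r : seq 'I_n) :
    uniq r -> (\sum_(j <- r) U_(j)%MM i)%N = (i \in r) :> nat.
  move=> r_uniq; under eq_bigr do rewrite mnm1E.
  rewrite -count_uniq_mem // -sum1_count [RHS]big_mkcond /=.
  by apply: eq_bigr => j _; rewrite eq_sym; case: eqVneq.
rewrite !cnt ?filter_uniq // mem_filter.
by case: (v i) => [|[|k]] //=; case: (i \in s).
Qed.

Inductive borel (n t : nat) (u : 'X_{1..n}) : 'X_{1..n} -> Prop :=
| borel_refl : borel t u u
| borel_step v (j i : 'I_n) : borel t u v -> v j != 0%N -> (i < j)%N ->
    t_spread t (v - U_(j) + U_(i))%MM -> borel t u (v - U_(j) + U_(i))%MM.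

Lemma borel_mdeg (n t : nat) (u v : 'X_{1..n}) : borel t u v -> mdeg v = mdeg u.
Proof.
elim=> // {}v j i _ <- vj _ _.
have le_jv : (U_(j) <= v)%MM by rewrite lep1mP.
by rewrite -{2}(submK le_jv) !mdegD !mdeg1.
Qed.

Lemma borel_stable (K : fieldType) (n t : nat) (u : 'X_{1..n}) :
    (1 <= t)%N -> t_spread t u ->
  t_spread_strongly_stable t
    (ideal_gen (fun q : {mpoly K[n]} => exists2 m, borel t u m & q = 'X_[m])).
Proof.
move=> t1 hu; split.
  by exists (borel t u) => // m; case.
move=> w j i _ /monomial_idealP Iw wj lt_ij hw'; apply/monomial_idealP => m.
rewrite msuppX inE => /eqP ->.
have [|v bv le_v] := Iw w; first by rewrite msuppX inE.
have [vj0|vj] := eqVneq (v j) 0%N.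
  exists v => //; apply/mnm_lepP => k; rewrite mnmDE mnmBE !mnm1E.
  have /mnm_lepP /(_ k) le_k := le_v.
  case: eqVneq => [<-|_]; first by rewrite vj0.
  by rewrite subn0 (leq_trans le_k) ?leq_addr.
have le' : (v - U_(j) + U_(i) <= w - U_(j) + U_(i))%MM.
  apply/mnm_lepP => k; rewrite !mnmDE !mnmBE leq_add2r leq_sub2r //.
  by have /mnm_lepP := le_v.
exists (v - U_(j) + U_(i))%MM => //.
by apply: borel_step => //; apply: t_spread_dvd le'.
Qed.

Lemma Bt_borel (K : fieldType) (n t : nat) (u : 'X_{1..n}) (p : {mpoly K[n]}) :
    (1 <= t)%N -> t_spread t u ->
  Bt t u p <-> ideal_gen (fun q => exists2 m, borel t u m & q = 'X_[m]) p.
Proof.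
move=> t1 hu; split=> [hp|hp I [[G tG hI] stI] Iu].
  apply: (hp (ideal_gen _)); first exact: borel_stable.
  by move=> I _; apply; exists u => //; constructor.
apply: hp => [|_ [v bv ->]].
  have [i0 iD iM] := ideal_gen_is_ideal (fun q : {mpoly K[n]} => exists2 m, G m & q = 'X_[m]).
  by split=> [|x y /hI hx /hI hy|a x /hI hx]; apply/hI; auto.
elim: bv => // {}v j i bv Iv vj lt_ij tv; apply: stI => //.
by case: bv.
Qed.

Lemma Bt_smallest (K : fieldType) (n t : nat) (u : 'X_{1..n}) :
    (1 <= t)%N -> t_spread t u ->
  [/\ t_spread_strongly_stable t (@Bt K n t u),
      @Bt K n t u 'X_[u]
    & forall I : {mpoly K[n]} -> Prop, t_spread_strongly_stable t I ->
        I 'X_[u] -> forall p, Bt t u p -> I p].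
Proof.
move=> t1 hu; split=> [|I _ //|I hI Iu p hp]; last exact: hp.
have [[G tG hG] st] := @borel_stable K n t u t1 hu; split.
  by exists G => // p; rewrite -hG; apply: Bt_borel.
move=> w j i tw /(Bt_borel _ t1 hu) Bw wj lt_ij tw'.
by apply/(Bt_borel _ t1 hu); apply: st.
Qed.

Lemma min_monomial_gen_Bt_mdeg (K : fieldType) (n t : nat) (u v : 'X_{1..n}) :
    (1 <= t)%N -> t_spread t u ->
  min_monomial_gen (@Bt K n t u) v -> mdeg v = mdeg u.
Proof.
move=> t1 hu [/(Bt_borel _ t1 hu)/monomial_idealP/(_ v)].
rewrite msuppX inE => /(_ (eqxx _)) [w bw le_w] /(_ w) <- //.
  exact: borel_mdeg bw.
by apply/(Bt_borel _ t1 hu) => I _; apply; exists w.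
Qed.

(* Main.v *)
(* Let R = K[B_t(u)] and encode a monomial by its partial sums of exponents.  *)
(* In these coordinates the degree k part of R is spanned by the lattice      *)
(* points of k P, where P is cut out by bounds on differences of coordinates. *)
(* Rounding down (y + s)/k for s = 0, ..., k - 1 factors every monomial of    *)
(* degree k into pairwise sortable generators. This factorization is unique,  *)
(* and it is the one that minimizes the sum over the factors of the squared   *)
(* differences of the coordinates. So R degenerates to a Stanley-Reisner ring *)
(* of a flag complex, whose residue field is resolved by words: after a word  *)
(* with set of admissible letters B, the letter c in B leads to the set {b in *)
(* B, b < c} together with all b not sortable with c. This linear resolution  *)
(* is lifted to R degree by degree; its differential is triangular for the    *)
(* order given by the weight and then by the words, which proves exactness.   *)
Require Import Defs.
From HB Require Import structures.
From mathcomp Require Import all_boot all_order all_algebra.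
From mathcomp Require Import mpoly.
From mathcomp Require Import zify ring.
From Stdlib Require Import ClassicalEpsilon.

Set Implicit Arguments.
Unset Strict Implicit.
Unset Printing Implicit Defensive.

Import Order.Theory GRing.Theory Num.Theory.
Local Open Scope ring_scope.

(** Monomials of degree [k] in R are the lattice points of [k P] ([layer]), and P bounds differences
    of partial sums by integers. Rounding respects such bounds ([layer_floor]), which yields the
    sorted factorization; its members are recognized by [factor]. A generator joins it once it is
    sortable with every member ([factor_sortable]), so the degenerate ring has only quadratic
    monomial relations. [letter_axioms] abstracts this: [M k] holds the monomials of degree [k],
    [letter b m] puts the generator [b] in the factorization of [m], [compat] is sortability, and
    [wt] is additive along sorted factorizations but drops at an unsortable pair.

    In the degenerate ring, the colon ideals met by the resolution are again generated by letters,
    hence linearity. Over R the differentials have the same leading terms ([triangular]). Every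
    element then reduces modulo the image ([triangular_reduce]), and no nonzero reduced element is a
    cycle ([triangular_inj]); [triangular_step] builds the next differential and [koszul_letters]
    reads off exactness. *)

Record letter_axioms (n q : nat) (M : nat -> 'X_{1..n} -> Prop)
    (mon : 'I_q -> 'X_{1..n}) (letter : 'I_q -> 'X_{1..n} -> bool)
    (compat : rel 'I_q) (wt : 'X_{1..n} -> nat) : Prop := LetterAxioms {
  ax_M0 : forall m, M 0 m <-> m = 0%MM;
  ax_MD : forall k l m p, M k m -> M l p -> M (k + l)%N (m + p)%MM;
  ax_mon : forall b, M 1 (mon b);
  ax_inj : injective mon;
  ax_compat_sym : forall b c, compat b c = compat c b;
  ax_letter_ex : forall k m, M k.+1 m -> exists b, letter b m;
  ax_letter_div : forall k m b, M k m -> letter b m ->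
    exists k' p, [/\ k = k'.+1, m = (mon b + p)%MM, M k' p
                   & wt m = (wt (mon b) + wt p)%N];
  ax_letter_cancel : forall k p b c, M k p -> letter b (mon b + p)%MM ->
    letter c (mon b + p)%MM -> c = b \/ letter c p;
  ax_letter_mul : forall k p b c, M k p -> letter b (mon b + p)%MM ->
    letter c p -> compat b c /\ letter c (mon b + p)%MM;
  ax_letter_compat : forall k p b, M k p ->
    (forall c, letter c p -> compat b c) -> letter b (mon b + p)%MM;
  ax_wtD : forall k l m p, M k m -> M l p -> (wt (m + p)%MM <= wt m + wt p)%N;
  ax_wt_incompat : forall b c, ~~ compat b c ->
    (wt (mon b + mon c)%MM < wt (mon b) + wt (mon c))%N }.

(** * A linear resolution indexed by words *)

Section Resolution.

Variables (K : fieldType) (n q : nat) (M : nat -> 'X_{1..n} -> Prop).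
Variables (mon : 'I_q -> 'X_{1..n}) (letter : 'I_q -> 'X_{1..n} -> bool).
Variables (compat : rel 'I_q) (wt : 'X_{1..n} -> nat).
Hypothesis ax : letter_axioms M mon letter compat wt.

Local Notation word := (seq 'I_q).
Local Notation A := {mpoly K[n]}.

(* Words are stored in reverse: the last letter of [c :: v] is c. [state w]   *)
(* is the set of letters that may follow w.                                   *)
Fixpoint state (w : word) : pred 'I_q :=
  if w is c :: v then
    fun b => (state v b && (b < c)%N) || ~~ compat c b
  else predT.

Fixpoint words (i : nat) : seq word :=
  if i is j.+1 then
    [seq c :: v | v <- words j, c <- [seq c <- enum 'I_q | state v c]]
  else [:: [::]].

Fixpoint word_code (w : word) : nat :=
  if w is c :: v then (word_code v * q + c)%N else 0.

Fixpoint word_weight (w : word) : nat :=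
  if w is c :: v then (wt (mon c) + word_weight v)%N else 0.

Lemma words_uniq i : uniq (words i).
Proof.
elim: i => //= i IH; apply: allpairs_uniq_dep => //.
  by move=> v _; rewrite filter_uniq // enum_uniq.
by move=> [v c] [v' c'] _ _ /= [-> ->].
Qed.

Lemma words_cons i c v : (c :: v \in words i.+1) = (v \in words i) && state v c.
Proof.
apply/allpairsPdep/andP => [[v' [c' [hv]]]|[hv hc]].
  by rewrite mem_filter => /andP[hc _] [-> ->].
by exists v, c; rewrite mem_filter hc mem_enum.
Qed.

Lemma wordsS i w : w \in words i.+1 ->
  exists c v, [/\ w = c :: v, v \in words i & state v c].
Proof.
case/allpairsPdep=> v [c [hv]]; rewrite mem_filter => /andP[hc _] ->.
by exists c, v.
Qed.

Definition betti (i : nat) : nat := size (words i).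

Definition nth_word i (j : 'I_(betti i)) : word := nth [::] (words i) j.

Lemma nth_word_in i (j : 'I_(betti i)) : nth_word j \in words i.
Proof. exact: mem_nth. Qed.

Lemma nth_word_inj i : injective (@nth_word i).
Proof.
move=> j k /eqP; rewrite nth_uniq // ?words_uniq // => /eqP.
exact: val_inj.
Qed.

Lemma nth_word_surj i w : w \in words i -> exists j : 'I_(betti i), nth_word j = w.
Proof.
move=> hw; have hj : (index w (words i) < betti i)%N by rewrite index_mem.
by exists (Ordinal hj); rewrite /nth_word nth_index.
Qed.

Definition bvec i (w : word) (m : 'X_{1..n}) : 'rV[A]_(betti i) :=
  \row_j (if nth_word j == w then 'X_[m] else 0).

Lemma mulX_bvec i w m p : 'X_[p] *: bvec i w m = bvec i w (m + p)%MM.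
Proof.
apply/rowP=> j; rewrite !mxE; case: eqP => _; rewrite ?mulr0 //.
by rewrite mpolyXD mulrC.
Qed.

Lemma mul_bvec i (j : 'I_(betti i)) m k (D : 'M[A]_(betti i, k)) :
  bvec i (nth_word j) m *m D = 'X_[m] *: row j D.
Proof.
have ->: bvec i (nth_word j) m = 'X_[m] *: delta_mx 0 j.
  apply/rowP=> l; rewrite !mxE eqxx (inj_eq (@nth_word_inj i)) /=.
  by case: eqP => _; rewrite ?mulr1 ?mulr0.
by rewrite -scalemxAl rowE.
Qed.

Implicit Types Q : word -> 'X_{1..n} -> Prop.

(** Membership in R, degrees and bounds on keys all take this form, so statements linear in the
    vector reduce to single terms by [supported_ind]. *)
Definition supported i Q (v : 'rV[A]_(betti i)) : Prop :=
  forall j m, m \in msupp (v 0 j) -> Q (nth_word j) m.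

Lemma supported0 i Q : @supported i Q 0.
Proof. by move=> j m; rewrite mxE msupp0. Qed.

Lemma supportedD i Q v w : @supported i Q v -> supported Q w -> supported Q (v + w).
Proof.
by move=> hv hw j m; rewrite mxE => /msuppD_le; rewrite mem_cat => /orP[/hv|/hw].
Qed.

Lemma supportedC i Q a v : @supported i Q v -> supported Q (a%:MP *: v).
Proof.
by move=> hv j m; rewrite mxE mul_mpolyC => /msuppZ_le /hv.
Qed.

Lemma supportedN i Q v : @supported i Q v -> supported Q (- v).
Proof. by move=> hv j m; rewrite mxE (perm_mem (msuppN _)) => /hv. Qed.

Lemma supportedB i Q v w : @supported i Q v -> supported Q w -> supported Q (v - w).
Proof. by move=> hv hw; apply: supportedD => //; apply: supportedN. Qed.

Lemma supported_sub i Q Q' v : @supported i Q v ->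
  (forall w m, w \in words i -> Q w m -> Q' w m) -> supported Q' v.
Proof. by move=> hv hQ j m /hv; apply: hQ; apply: nth_word_in. Qed.

Lemma supportedI i Q Q' v : @supported i Q v -> supported Q' v ->
  supported (fun w m => Q w m /\ Q' w m) v.
Proof. by move=> h h' j m hm; split; [apply: h | apply: h']. Qed.

Lemma supportedX i Q Q' p v : @supported i Q v ->
  (forall w m, w \in words i -> Q w m -> Q' w (m + p)%MM) ->
  supported Q' ('X_[p] *: v).
Proof.
move=> hv hQ j m; rewrite mxE mulrC (perm_mem (msuppMX _ _)).
by case/mapP=> m' /hv hm' ->; rewrite addmC; apply: hQ => //; apply: nth_word_in.
Qed.

Lemma supported_bvec i Q w m : Q w m -> supported Q (bvec i w m).
Proof.
move=> hQ j p; rewrite mxE; case: eqP => [->|_]; last by rewrite msupp0.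
by rewrite msuppX inE => /eqP ->.
Qed.

Lemma row_bvec i (v : 'rV[A]_(betti i)) :
  v = \sum_j \sum_(m <- msupp (v 0 j)) ((v 0 j)@_m)%:MP *: bvec i (nth_word j) m.
Proof.
apply/rowP=> k; rewrite summxE (bigD1 k) //= [X in _ + X]big1 => [|j jk].
  rewrite addr0 {1}[v 0 k]mpolyE summxE; apply: eq_bigr => m _.
  by rewrite !mxE eqxx mul_mpolyC.
rewrite summxE big1 // => m _; rewrite !mxE (inj_eq (@nth_word_inj i)).
by rewrite eq_sym (negPf jk) mulr0.
Qed.

Lemma supported_ind i Q (P : 'rV[A]_(betti i) -> Prop) :
    P 0 -> (forall x y, P x -> P y -> P (x + y)) ->
    (forall a x, P x -> P (a%:MP *: x)) ->
    (forall w m, w \in words i -> Q w m -> P (bvec i w m)) ->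
  forall v, supported Q v -> P v.
Proof.
move=> P0 PD PZ PE v hv; rewrite [v]row_bvec; apply: big_ind => // j _.
rewrite big_seq; apply: big_ind => // m /hv hm; apply: PZ; apply: PE => //.
exact: nth_word_in.
Qed.

Lemma supported_coef i Q (v : 'rV[A]_(betti i)) j m :
  supported Q v -> ~ Q (nth_word j) m -> (v 0 j)@_m = 0.
Proof.
by move=> hv nQ; apply/eqP; rewrite mcoeff_eq0; apply/negP => /hv.
Qed.

(** These monomials form a basis of the degenerate ring modulo the ideal generated by the letters in
    [state w]. *)
Definition reduced (w : word) (m : 'X_{1..n}) : bool :=
  [forall c, state w c ==> ~~ letter c m].

Lemma reducedP w m : reflect (forall c, state w c -> ~ letter c m) (reduced w m).
Proof.
apply: (iffP forallP) => h c; first by move=> hs; apply/negP; apply: (implyP (h c)).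
by apply/implyP => /h /negP.
Qed.

(** A lexicographic order packed into one number: the total weight, then the word as a number in
    base [q] whose leading digit is its first letter. *)
Definition key (w : word) (m : 'X_{1..n}) : nat :=
  ((word_weight w + wt m) * q ^ size w + word_code w)%N.

Lemma size_words i w : w \in words i -> size w = i.
Proof.
elim: i w => [|i IH] w; first by rewrite inE => /eqP ->.
by case/wordsS=> c [v [-> /IH <- _]].
Qed.

(* [(c :: v, p)] with p reduced is matched with the non-reduced [(v, c p)]:   *)
(* c is recovered as the least letter of c p in [state v]. The differential   *)
(* sends each such element to its match plus terms of smaller key, so it is   *)
(* injective on reduced elements and its image complements them.              *)
Lemma reduced_letter k v c p : M k p -> reduced (c :: v) p ->
  letter c (mon c + p)%MM.
Proof.
move=> Mp /reducedP /= hD; apply: (ax_letter_compat ax Mp) => e he.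
by apply/negPn/negP => hn; apply: (hD e) he; rewrite hn orbT.
Qed.

Lemma reduced_min k v c p e : M k p -> reduced (c :: v) p ->
  state v e -> letter e (mon c + p)%MM -> (c <= e)%N.
Proof.
move=> Mp hD he; have hc := reduced_letter Mp hD.
case/(ax_letter_cancel ax Mp hc) => [->//|hl].
rewrite leqNgt; apply/negP => lt_ec.
by move/reducedP: hD => /(_ e); apply=> //=; rewrite he lt_ec.
Qed.

Lemma reduced_wt k v c p : M k p -> reduced (c :: v) p ->
  wt (mon c + p)%MM = (wt (mon c) + wt p)%N.
Proof.
move=> Mp hD; have hc := reduced_letter Mp hD.
have Mcp := ax_MD ax (ax_mon ax c) Mp.
have [k' [p' [_ /eqP + _ ->]]] := ax_letter_div ax Mcp hc.
by rewrite addmC [X in _ == X]addmC eqm_add2r => /eqP ->.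
Qed.

Lemma reduced_key k v c p : M k p -> reduced (c :: v) p ->
  key (c :: v) p = (q * key v (mon c + p) + c)%N.
Proof.
move=> Mp hD; rewrite /key (reduced_wt Mp hD) /= expnS; ring.
Qed.

Lemma nonreduced_split k v m : M k m -> ~~ reduced v m ->
  exists k' c p, [/\ k = k'.+1, M k' p, m = (mon c + p)%MM, state v c &
    reduced (c :: v) p] /\
    forall e, state v e -> letter e m -> (c <= e)%N.
Proof.
move=> Mm; rewrite negb_forall => /existsP[c0]; rewrite negb_imply negbK => h0.
pose c := [arg min_(c < c0 | state v c && letter c m) (c : nat)].
have [hs hl hmin] : [/\ state v c, letter c m &
    forall e, state v e -> letter e m -> (c <= e)%N].
  rewrite /c; case: arg_minnP => // e /andP[he1 he2] hm.
  by split=> // f f1 f2; apply: hm; rewrite f1.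
have [k' [p [-> def_m Mp _]]] := ax_letter_div ax Mm hl.
exists k', c, p; split=> //; split=> //.
apply/reducedP => e /= se le.
have hl' : letter c (mon c + p)%MM by rewrite -def_m.
have [hc he] := ax_letter_mul ax Mp hl' le.
move: se; rewrite hc orbF => /andP[se lt_e].
by have := hmin e se; rewrite def_m => /(_ he); rewrite leqNgt lt_e.
Qed.

Lemma reduced_uniq k k' v c c' p p' : M k p -> M k' p' -> state v c -> state v c' ->
  reduced (c :: v) p -> reduced (c' :: v) p' -> (mon c + p = mon c' + p')%MM ->
  c = c' /\ p = p'.
Proof.
move=> Mp Mp' hc hc' hD hD' e.
have ecc : c = c'.
  apply: val_inj; apply/eqP; rewrite eqn_leq; apply/andP; split.
    by apply: (reduced_min Mp hD) => //; rewrite e; apply: reduced_letter Mp' hD'.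
  by apply: (reduced_min Mp' hD') => //; rewrite -e; apply: reduced_letter Mp hD.
split=> //; move/eqP: e; rewrite -ecc addmC [X in _ == X]addmC eqm_add2r.
by move/eqP.
Qed.

(** * Reduction and injectivity for triangular differentials *)

Definition triangular i (D : 'M[A]_(betti i.+1, betti i)) : Prop :=
  forall c v, c :: v \in words i.+1 ->
    supported (fun w m => M 1 m /\ (key w m < key v (mon c))%N)
      (bvec i.+1 (c :: v) 0%MM *m D - bvec i v (mon c)).

Lemma key_mul k l w m p : M k m -> M l p ->
  (key w (m + p)%MM <= key w m + wt p * q ^ size w)%N.
Proof.
move=> Mm Mp; rewrite /key addnAC leq_add2r -mulnDl leq_mul2r -addnA leq_add2l.
by rewrite (ax_wtD ax Mm Mp) orbT.
Qed.

Lemma triangular_mul i (D : 'M[A]_(betti i.+1, betti i)) c v k p : triangular D ->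
    c :: v \in words i.+1 -> M k p ->
  exists r, bvec i.+1 (c :: v) p *m D = bvec i v (mon c + p)%MM + r /\
    supported (fun w m => M k.+1 m /\
      (key w m < key v (mon c) + wt p * q ^ i)%N) r.
Proof.
move=> gD hw Mp; have := gD _ _ hw; set r := _ - _ => hr.
exists ('X_[p] *: r); split.
  by rewrite /r scalerBr scalemxAl !mulX_bvec add0m addrC subrK.
apply: supportedX hr _ => w m iw [Mm hk]; split; first exact: (ax_MD ax Mm Mp).
apply: leq_ltn_trans (key_mul w Mm Mp) _.
by rewrite (size_words iw) ltn_add2r.
Qed.

Lemma triangular_mul_reduced i (D : 'M[A]_(betti i.+1, betti i)) c v k p : triangular D ->
    c :: v \in words i.+1 -> M k p -> reduced (c :: v) p ->
  exists r, bvec i.+1 (c :: v) p *m D = bvec i v (mon c + p)%MM + r /\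
    supported (fun w m => M k.+1 m /\ (key w m < key v (mon c + p)%MM)%N) r.
Proof.
move=> gD hw Mp hD; have [r [-> hr]] := triangular_mul gD hw Mp; exists r; split=> //.
apply: supported_sub hr _ => w m _ [Mm hk]; split=> //; apply: leq_trans hk _.
move: hw; rewrite words_cons => /andP[/size_words hv _].
by rewrite /key (reduced_wt Mp hD) hv; apply/eq_leq; ring.
Qed.

(** A non-reduced element is the image of its match up to terms of smaller key, so recursion on the
    key ends. Of the two bounds on the keys in [g], the finer one holds when a letter of [m] lies in
    [state w]; [triangular_step] needs both. *)
Lemma triangular_reduce_bvec i (D : 'M[A]_(betti i.+1, betti i)) : triangular D ->
  forall k w m, w \in words i -> M k m ->
  exists (g : 'rV_(betti i.+1)) (x : 'rV_(betti i)),
    [/\ bvec i w m = g *m D + x,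
        supported (fun w' p => M k p /\ reduced w' p) x &
        supported (fun w' p => [/\ exists2 k', k = k'.+1 & M k' p, reduced w' p,
           (key w' p < q * (key w m).+1)%N &
           forall e, state w e -> letter e m -> (key w' p <= q * key w m + e)%N])
          g].
Proof.
move=> gD k w m; have [N leN] := ubnP (key w m).
elim: N => // N IH in w m leN *; move=> hw Mm.
have [hD|hU] := boolP (reduced w m).
  exists 0, (bvec i w m); rewrite mul0mx add0r; split=> //; last exact: supported0.
  exact: supported_bvec.
have [k' [c [p [[ek Mp em sc hD] cmin]]]] := nonreduced_split Mm hU.
have hcw : c :: w \in words i.+1 by rewrite words_cons hw sc.
have [r [er hr]] := triangular_mul_reduced gD hcw Mp hD; rewrite -em -ek in er hr.
have [g [x [e hx hg]]] : exists (g : 'rV_(betti i.+1)) (x : 'rV_(betti i)),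
    [/\ r = g *m D + x,
        supported (fun w' p => M k p /\ reduced w' p) x &
        supported (fun w' p => [/\ exists2 k', k = k'.+1 & M k' p, reduced w' p &
           (key w' p < q * key w m)%N]) g].
  move: r {er} hr; apply: supported_ind.
  - by exists 0, 0; rewrite mul0mx addr0; split=> //; apply: supported0.
  - move=> x y [g [x' [-> hx' hg]]] [h [y' [-> hy' hh]]].
    by exists (g + h), (x' + y'); rewrite mulmxDl addrACA; split=> //; apply: supportedD.
  - move=> a x [g [x' [-> hx' hg]]]; exists (a%:MP *: g), (a%:MP *: x').
    by rewrite scalerDr scalemxAl; split=> //; apply: supportedC.
  - move=> w' m' iw' [Mm' ltk].
    have [||//|g [x [e hx hg]]] := IH w' m'.
    + exact: leq_trans ltk _.
    + by [].
    exists g, x; split=> //; apply: supported_sub hg _ => w2 m2 _ [h1 h2 h3 _].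
    by split=> //; apply: leq_trans h3 _; rewrite leq_mul2l ltk orbT.
exists (bvec i.+1 (c :: w) p - g), (- x); split; last first.
- apply: supportedB.
    apply: supported_bvec; split=> //; first by exists k'.
      by rewrite (reduced_key Mp hD) -em mulnS addnC ltn_add2r.
    by move=> e' se' le'; rewrite (reduced_key Mp hD) -em leq_add2l cmin.
  apply: supported_sub hg _ => w' p' _ [h1 h2 h3]; split=> //.
    by apply: leq_trans h3 _; rewrite leq_mul2l leqnSn orbT.
  by move=> e' _ _; apply: leq_trans (ltnW h3) (leq_addr _ _).
- exact: supportedN.
- by rewrite mulmxBl er e -addrA -opprD addrK.
Qed.

Lemma triangular_reduce i (D : 'M[A]_(betti i.+1, betti i)) (L : nat -> Prop) : triangular D ->
  forall v, supported (fun _ m => exists2 k, L k & M k m) v ->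
  exists (g : 'rV_(betti i.+1)) (x : 'rV_(betti i)),
    [/\ v = g *m D + x,
        supported (fun w p => reduced w p /\ exists2 k, L k & M k p) x &
        supported (fun w p => reduced w p /\ exists2 k, L k.+1 & M k p) g].
Proof.
move=> gD; apply: supported_ind.
- by exists 0, 0; rewrite mul0mx addr0; split=> //; apply: supported0.
- move=> x y [g [x' [-> hx' hg]]] [h [y' [-> hy' hh]]].
  by exists (g + h), (x' + y'); rewrite mulmxDl addrACA; split=> //; apply: supportedD.
- move=> a x [g [x' [-> hx' hg]]]; exists (a%:MP *: g), (a%:MP *: x').
  by rewrite scalerDr scalemxAl; split=> //; apply: supportedC.
move=> w m hw [k Lk Mm]; have [g [x [-> hx hg]]] := triangular_reduce_bvec gD hw Mm.
exists g, x; split=> //.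
  by apply: supported_sub hx _ => w' p _ [Mp hD]; split=> //; exists k.
apply: supported_sub hg _ => w' p _ [[k' ek Mp] hD _ _]; split=> //.
by exists k'; rewrite -?ek.
Qed.

(* The key of the match of [(w, p)].                                          *)
Definition lead_key (w : word) (p : 'X_{1..n}) : nat :=
  if w is c :: v then key v (mon c + p)%MM else 0.

(** A term of [x] with greatest [lead_key] cannot cancel: distinct reduced elements have distinct
    matches, and all lower terms have smaller keys. *)
Lemma triangular_inj i (D : 'M[A]_(betti i.+1, betti i)) : triangular D ->
  forall x, supported (fun w p => reduced w p /\ exists k, M k p) x ->
  x *m D = 0 -> x = 0.
Proof.
move=> gD x hx xD0.
have [N hN] : exists N, supported (fun w p => (lead_key w p < N)%N) x.
  move: x hx {xD0}; apply: supported_ind.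
  - by exists 0%N; apply: supported0.
  - move=> y z [k hy] [l hz]; exists (k + l)%N.
    apply: supportedD; [apply: supported_sub hy _ | apply: supported_sub hz _] => w p _ h.
      exact: leq_trans h (leq_addr _ _).
    exact: leq_trans h (leq_addl _ _).
  - by move=> a y [k hy]; exists k; apply: supportedC.
  - by move=> w p _ _; exists (lead_key w p).+1; apply: supported_bvec.
elim: N hN => [|N IH] hN.
  apply/rowP=> j; rewrite mxE; apply/eqP; rewrite -msupp_eq0.
  by case E0: (msupp _) => [//|m s]; have := hN j m; rewrite E0 mem_head => /(_ isT).
apply: IH => j p hp; have := hN j p hp; rewrite ltnS leq_eqVlt => /orP[/eqP eN|//].
have [hD [k Mp]] := hx j p hp; move: (nth_word_in j) eN hD.
have [c [v [ew hv sc]]] := wordsS (nth_word_in j).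
rewrite ew /= => hw eN hD.
set a := (x 0 j)@_p; set x' := x - a%:MP *: bvec i.+1 (nth_word j) p.
have hx' : supported (fun w m => [/\ reduced w m, exists k, M k m, (lead_key w m <= N)%N
                             & ~ (w = c :: v /\ m = p)]) x'.
  move=> l m hm.
  have [hl1 hl2] : (reduced (nth_word l) m /\ exists k, M k m) /\ (lead_key (nth_word l) m <= N)%N.
    have : supported (fun w p => (reduced w p /\ exists k, M k p) /\ (lead_key w p <= N)%N) x'.
      apply: supportedB; first exact: supportedI.
      by apply: supportedC; apply: supported_bvec; rewrite ew /= eN; split=> //; split=> //; exists k.
    exact.
  case: hl1 => h1 h2; split=> //.
  rewrite -ew => -[/nth_word_inj el em]; move: hm; rewrite el em mcoeff_msupp.
  by rewrite !mxE eqxx mul_mpolyC mcoeffB mcoeffZ mcoeffX eqxx mulr1 subrr eqxx.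
(* Leading terms of the image of [x'] miss this position by [reduced_uniq], the other terms because
   their keys are below [N]. *)
have hx'D : supported (fun w m => ~ (w = v /\ m = (mon c + p)%MM)) (x' *m D).
  move: (x') hx'; apply: supported_ind.
  - by rewrite mul0mx; apply: supported0.
  - by move=> y z; rewrite mulmxDl; apply: supportedD.
  - by move=> e y; rewrite -scalemxAl; apply: supportedC.
  move=> w m hw' [hDm [k' Mm]].
  have [c' [v' [ew' hv' sc']]] := wordsS hw'; rewrite {w}ew' in hw' hDm *.
  move=> /= le_N nwm.
  have [r [-> hr]] := triangular_mul_reduced gD hw' Mm hDm; apply: supportedD.
    apply: supported_bvec => -[ev em]; apply: nwm; rewrite ev in sc' hDm *.
    by have [-> ->] := reduced_uniq Mm Mp sc' sc hDm hD em.
  apply: supported_sub hr _ => w2 m2 _ [_ lt2] [e1 e2]; move: lt2.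
  by rewrite e1 e2 eN ltnNge le_N.
have [jv ejv] := nth_word_surj hv.
have /(congr1 (fun r : 'rV_(betti i) => (r 0 jv)@_(mon c + p)%MM)) : 
    a%:MP *: bvec i.+1 (nth_word j) p *m D + x' *m D = 0.
  by rewrite -mulmxDl addrC subrK.
have [r [er hr]] := triangular_mul_reduced gD hw Mp hD.
rewrite ew -scalemxAl er [(_ + _ : 'rV_ _) _ _]mxE mcoeffD (supported_coef hx'D); last first.
  by apply; rewrite ejv.
rewrite !mxE mulrDr mcoeffD !mul_mpolyC !mcoeffZ (supported_coef hr); last first.
  by rewrite ejv ltnn => -[].
rewrite ejv eqxx mcoeffX eqxx mulr1 mulr0 !addr0 mcoeff0 => a0.
by move: hp; rewrite mcoeff_msupp -/a a0 eqxx.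
Qed.

(** * Construction of the differentials and exactness *)

Lemma matrix_rows m k (P : 'I_m -> 'rV[A]_k -> Prop) :
  (forall j, exists r, P j r) -> exists D : 'M[A]_(m, k), forall j, P j (row j D).
Proof.
move=> h; have [f hf] := fin_all_exists h.
by exists (\matrix_j f j) => j; rewrite rowK.
Qed.

Lemma bvec0_mul i (j : 'I_(betti i)) k (D : 'M[A]_(betti i, k)) :
  bvec i (nth_word j) 0%MM *m D = row j D.
Proof. by rewrite mul_bvec mpolyX0 scale1r. Qed.

Lemma triangular_rows i (P : 'rV[A]_(betti i) -> Prop) :
    (forall c v, c :: v \in words i.+1 -> exists2 r, P r &
      supported (fun w m => M 1 m /\ (key w m < key v (mon c))%N) (r - bvec i v (mon c))) ->
  exists2 D : 'M[A]_(betti i.+1, betti i), forall j, P (row j D) & triangular D.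
Proof.
move=> h.
pose P' (j : 'I_(betti i.+1)) (r : 'rV[A]_(betti i)) := P r /\ forall c v, nth_word j = c :: v ->
  supported (fun w m => M 1 m /\ (key w m < key v (mon c))%N) (r - bvec i v (mon c)).
have [|D hD] := @matrix_rows _ _ P'.
  move=> j; have := nth_word_in j; rewrite /P'.
  have [c [v [-> _ _]]] := wordsS (nth_word_in j) => /h[r Pr hr].
  by exists r; split=> // c' v' [<- <-].
exists D => [j|c v hw]; first by have [] := hD j.
have [j ej] := nth_word_surj hw; rewrite -ej bvec0_mul.
by have [_] := hD j; apply.
Qed.

Lemma triangular_base : exists D : 'M[A]_(betti 1, betti 0), triangular D.
Proof.
have [|D _ gD] := @triangular_rows 0 (fun _ => True); last by exists D.
by move=> c v _; exists (bvec 0 v (mon c)); rewrite // subrr; apply: supported0.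
Qed.

(** Degree 2 suffices, because the rows of the next differential come from reducing elements of
    degree 2. *)
Definition reduced_image0 i (D : 'M[A]_(betti i.+1, betti i)) : Prop :=
  forall h x, supported (fun w p => reduced w p /\ M 2 p) x -> x = h *m D -> x = 0.

Lemma reduced_image0_base (D : 'M[A]_(betti 1, betti 0)) : reduced_image0 D.
Proof.
move=> h x hx _; apply/rowP=> j; rewrite mxE; apply/eqP; rewrite -msupp_eq0.
case E0: (msupp _) => [//|m s]; have := hx j m; rewrite E0 mem_head.
case=> // /reducedP hD /(ax_letter_ex ax)[c]; case/hD.
by have := nth_word_in j; rewrite inE => /eqP ->.
Qed.

(** For a word [e :: c :: v], the image under [D] of [mon e] at [c :: v] is reduced to [g *m D + x].
    The remainder [x] is itself in the image of [D], so it vanishes by [reduced_image0], and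
    subtracting [g] gives a syzygy. *)
Lemma triangular_step i (D : 'M[A]_(betti i.+1, betti i)) : triangular D -> reduced_image0 D ->
  exists D' : 'M[A]_(betti i.+2, betti i.+1), [/\ triangular D', reduced_image0 D' & D' *m D = 0].
Proof.
move=> gD cD.
have [D' D'D gD'] : exists2 D' : 'M[A]_(betti i.+2, betti i.+1),
    forall j, row j D' *m D = 0 & triangular D'; last first.
  have D'D0 : D' *m D = 0 by apply/row_matrixP=> j; rewrite row_mul D'D row0.
  exists D'; split=> // h x hx ex; apply: (triangular_inj gD).
    by apply: supported_sub hx _ => w p _ [hD Mp]; split=> //; exists 2%N.
  by rewrite ex -mulmxA D'D0 mulmx0.
apply: (@triangular_rows _ (fun r => r *m D = 0)) => e w; rewrite words_cons => /andP[hw].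
have [c [v [ew hv sc]]] := wordsS hw; rewrite {w}ew in hw * => /= se.
set B := (key v (mon c) + wt (mon e) * q ^ i)%N.
have MM : M 2 (mon c + mon e)%MM by apply: (ax_MD ax (ax_mon ax c) (ax_mon ax e)).
have kB : key (c :: v) (mon e) = (q * B + c)%N.
  by rewrite /B /key /= (size_words hv) expnS; ring.
have [g [x [eg hx hg]]] : exists (g : 'rV_(betti i.+1)) (x : 'rV_(betti i)),
    [/\ bvec i.+1 (c :: v) (mon e) *m D = g *m D + x,
        supported (fun w p => reduced w p /\ M 2 p) x &
        supported (fun w p => M 1 p /\ (key w p < q * B + c)%N) g].
  have [r [-> hr]] := triangular_mul gD hw (ax_mon ax e).
  have [g2 [x2 [e2 hx2 hg2]]] : exists (g : 'rV_(betti i.+1)) (x : 'rV_(betti i)),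
    [/\ r = g *m D + x,
        supported (fun w p => reduced w p /\ M 2 p) x &
        supported (fun w p => M 1 p /\ (key w p < q * B + c)%N) g].
    move: r hr; apply: supported_ind.
    - by exists 0, 0; rewrite mul0mx addr0; split=> //; apply: supported0.
    - move=> x y [g [x' [-> hx' hg]]] [h [y' [-> hy' hh]]].
      by exists (g + h), (x' + y'); rewrite mulmxDl addrACA; split=> //; apply: supportedD.
    - move=> a x [g [x' [-> hx' hg]]]; exists (a%:MP *: g), (a%:MP *: x').
      by rewrite scalerDr scalemxAl; split=> //; apply: supportedC.
    move=> w m hw' [Mm lt_m]; have [g [x [-> hx hg]]] := triangular_reduce_bvec gD hw' Mm.
    exists g, x; split=> //; first by apply: supported_sub hx _ => ? ? _ [].
    apply: supported_sub hg _ => w' p _ [[k' [<-] Mp] _ lt_p _]; split=> //.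
    by apply: leq_trans lt_p (leq_trans _ (leq_addr _ _)); rewrite leq_mul2l lt_m orbT.
  have [g1 [x1 [-> hx1 hg1]]] := triangular_reduce_bvec gD hv MM.
  exists (g1 + g2), (x1 + x2); rewrite e2 mulmxDl addrACA; split=> //.
    by apply: supportedD => //; apply: supported_sub hx1 _ => ? ? _ [].
  apply: supportedD => //; apply: supported_sub hg1 _ => w' p _ [[k' [<-] Mp] _ lt_p le_p].
  (* If [e] is compatible with [c], it is a letter of the product, lies in [state v] and precedes
     [c], so the finer bound gives last digit [e < c]. Otherwise the weight of the product drops and
     the coarse bound is enough. *)
  split=> //; case: (boolP (compat c e)) => [ce|nce].
    have [sve lt_ec] : state v e /\ (e < c)%N.
      by apply/andP; move: se; rewrite ce orbF.
    have le_e : letter e (mon c + mon e)%MM.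
      rewrite addmC; apply: (ax_letter_compat ax (ax_mon ax c)) => f lf.
      have [k2 [p2 [[<-] ef M0 _]]] := ax_letter_div ax (ax_mon ax c) lf.
      move: ef; have -> := (ax_M0 ax _).1 M0; rewrite addm0 => /(ax_inj ax) <-.
      by rewrite (ax_compat_sym ax).
    apply: leq_ltn_trans (le_p e sve le_e) _.
    rewrite -addnS leq_add // leq_mul2l /B -(size_words hv).
    by rewrite (key_mul _ (ax_mon ax c) (ax_mon ax e)) orbT.
  apply: leq_trans lt_p (leq_trans _ (leq_addr _ _)).
  rewrite leq_mul2l; apply/orP; right; rewrite /B /key (size_words hv).
  rewrite addnAC -mulnDl -addSn -addnA leq_add2r.
  have := ax_wt_incompat ax nce; have : (0 < q ^ i)%N; last by nia.
  by rewrite expn_gt0 (leq_ltn_trans (leq0n c) (ltn_ord c)).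
have x0 : x = 0.
  apply: (cD (bvec i.+1 (c :: v) (mon e) - g)) hx _.
  by rewrite mulmxBl eg addrC addKr.
exists (bvec i.+1 (c :: v) (mon e) - g).
  by rewrite mulmxBl eg x0 addr0 subrr.
rewrite addrC addKr kB; exact: supportedN.
Qed.

Lemma triangular_complex : exists d : forall i, 'M[A]_(betti i.+1, betti i),
  (forall i, triangular (d i)) /\ forall i, d i.+1 *m d i = 0.
Proof.
pose st i := {D : 'M[A]_(betti i.+1, betti i) | triangular D /\ reduced_image0 D}.
have next i (D : st i) : {D' : st i.+1 | sval D' *m sval D = 0}.
  (* Each differential depends on the previous one, so the mere existence of a next one must become
     data before recursion. *)
  apply: constructive_indefinite_description; case: D => D /= [gD cD].
  by have [D' [gD' cD' e]] := triangular_step gD cD; exists (exist _ D' (conj gD' cD')).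
have [D0 gD0] := triangular_base.
pose f := nat_rect st (exist _ D0 (conj gD0 (@reduced_image0_base D0)))
  (fun i D => sval (next i D)).
exists (fun i => sval (f i)); split=> i; first by have [] := svalP (f i).
exact: svalP (next i (f i)).
Qed.

Lemma supported_mx_over i (P : A -> Prop) (L : 'X_{1..n} -> Prop) (v : 'rV[A]_(betti i)) :
    (forall p, P p <-> forall m, m \in msupp p -> L m) ->
  mx_over P v <-> supported (fun _ m => L m) v.
Proof.
move=> hP; split=> [hv j m|hv j k]; first exact: (hP _).1.
by apply/hP => m; rewrite (ord1 j); apply: hv.
Qed.

Lemma irrelevantP (gr : nat -> A -> Prop) (x : A) :
    (forall k p, gr k p <-> forall m, m \in msupp p -> M k m) ->
  irrelevant gr x <-> forall m, m \in msupp x -> exists2 k, (0 < k)%N & M k m.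
Proof.
move=> hgr; split=> [[N [f [hf ->]]]|hx].
  apply: (big_ind (fun p => forall m, m \in msupp p -> exists2 k, (0 < k)%N & M k m)).
  - by move=> m; rewrite msupp0.
  - by move=> y z hy hz m /msuppD_le; rewrite mem_cat => /orP[/hy|/hz].
  - by move=> k _ m /((hgr _ _).1 (hf k)); exists k.+1.
have gr0 k : gr k 0 by apply/hgr => m; rewrite msupp0.
have grD k p r : gr k p -> gr k r -> gr k (p + r).
  move=> /hgr hp /hgr hr; apply/hgr => m /msuppD_le.
  by rewrite mem_cat => /orP[/hp|/hr].
rewrite [x]mpolyE big_seq; apply: big_ind => [|y z|m /hx[[//|k] _ Mm]].
- by exists 0%N, (fun _ => 0); rewrite big_ord0.
- move=> [N1 [f1 [h1 ->]]] [N2 [f2 [h2 ->]]].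
  exists (maxn N1 N2), (fun k => (if (k < N1)%N then f1 k else 0) +
    (if (k < N2)%N then f2 k else 0)); split.
    by move=> k; apply: grD; case: ifP.
  rewrite big_split /= (big_ord_widen _ f1 (leq_maxl N1 N2)).
  by rewrite (big_ord_widen _ f2 (leq_maxr N1 N2)) -!big_mkcond.
exists k.+1, (fun l => if l == k then x@_m *: 'X_[m] else 0); split.
  move=> l; case: eqP => [->|_] //; apply/hgr => p /msuppZ_le.
  by rewrite msuppX inE => /eqP ->.
rewrite big_ord_recr /= eqxx big1 ?add0r // => l _.
by rewrite ltn_eqF.
Qed.

(** A cycle reduces modulo the image to a reduced cycle, which is zero by [triangular_inj]. At
    position 0 the remainder vanishes since the empty word admits every letter and every monomial of
    positive degree has one. *)
Theorem koszul_letters (R : A -> Prop) (gr : nat -> A -> Prop) :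
    (forall p, R p <-> forall m, m \in msupp p -> exists k, M k m) ->
    (forall k p, gr k p <-> forall m, m \in msupp p -> M k m) ->
  koszul R gr.
Proof.
move=> hR hgr; have [d [gd dd]] := triangular_complex.
exists betti, d; split=> //.
- move=> i j k; apply/hgr => m hm; have hw := nth_word_in j.
  have [c [v [ew hv sc]]] := wordsS hw; rewrite ew in hw.
  have := gd i c v hw; rewrite -ew bvec0_mul => hS.
  suff : supported (fun _ m => M 1 m) (row j (d i)) by move/(_ k m); rewrite mxE; apply.
  rewrite -[row j _](subrK (bvec i v (mon c))); apply: supportedD.
    by apply: supported_sub hS _ => ? ? _ [].
  by apply: supported_bvec; apply: (ax_mon ax).
- move=> v _; rewrite (supported_mx_over _ (fun p => irrelevantP p hgr)); split.
    move=> hv; have [g [x [-> hx hg]]] := triangular_reduce (gd 0%N) hv.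
    have -> : x = 0.
      apply/rowP=> j; rewrite mxE; apply/eqP; rewrite -msupp_eq0.
      case E0: (msupp _) => [//|m s]; have := hx j m; rewrite E0 mem_head.
      case=> // /reducedP hD [[//|k] _ /(ax_letter_ex ax)[c]]; case/hD.
      by have := nth_word_in j; rewrite inE => /eqP ->.
    exists g; last by rewrite addr0.
    apply/(supported_mx_over _ hR); apply: supported_sub hg _ => w p _ [_ [k _ Mp]].
    by exists k.
  case=> w /(supported_mx_over _ hR) hw ->; move: w hw; apply: supported_ind.
  + by rewrite mul0mx; apply: supported0.
  + by move=> y z; rewrite mulmxDl; apply: supportedD.
  + by move=> a y; rewrite -scalemxAl; apply: supportedC.
  move=> w m hw [k Mm]; have [c [v' [ew _ _]]] := wordsS hw; rewrite ew in hw *.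
  have [r [-> hr]] := triangular_mul (gd 0%N) hw Mm; apply: supportedD.
    by apply: supported_bvec; exists k.+1 => //; apply: (ax_MD ax (ax_mon ax c) Mm).
  by apply: supported_sub hr _ => ? ? _ [h _]; exists k.+1.
move=> i v /(supported_mx_over _ hR) hv; split=> [vd0|[w _ ->]]; last first.
  by rewrite -mulmxA dd mulmx0.
have [||g [x [ev hx hg]]] := @triangular_reduce i.+1 (d i.+1) (fun _ => True) _ v.
- exact: gd.
- by apply: supported_sub hv _ => _ m _ [k Mm]; exists k.
have x0 : x = 0.
  apply: (triangular_inj (gd i)).
    by apply: supported_sub hx _ => w m _ [hD [k _ Mm]]; split=> //; exists k.
  by move: vd0; rewrite ev mulmxDl -mulmxA dd mulmx0 add0r.
exists g; last by rewrite ev x0 addr0.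
by apply/(supported_mx_over _ hR); apply: supported_sub hg _ => w p _ [_ [k _ Mp]]; exists k.
Qed.

End Resolution.

(** * Partial sums of exponents as coordinates *)

Definition psum (n : nat) (m : 'X_{1..n}) (c : nat) : nat :=
  (\sum_(i < n | (i < c)%N) m i)%N.

Section PartialSums.
Variable n : nat.
Implicit Types m p : 'X_{1..n}.

Lemma psum0 m : psum m 0 = 0%N.
Proof. by rewrite /psum big_pred0. Qed.

Lemma psumD m p c : psum (m + p)%MM c = (psum m c + psum p c)%N.
Proof. by rewrite /psum -big_split; apply: eq_bigr => i _; rewrite mnmDE. Qed.

Lemma psum_mnm0 c : psum (0%MM : 'X_{1..n}) c = 0%N.
Proof. by rewrite /psum big1 // => i _; rewrite mnm0E. Qed.

Lemma psum_mnm1 (i : 'I_n) c : psum U_(i)%MM c = (i < c)%N.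
Proof.
rewrite /psum; case: ltnP => h.
  rewrite (bigD1 i) //= mnm1E eqxx big1 ?addn0 // => j /andP[_ ne].
  by rewrite mnm1E eq_sym (negPf ne).
rewrite big1 // => j lt_j; rewrite mnm1E; case: eqP => // e.
by move: lt_j; rewrite -e ltnNge h.
Qed.

Lemma psum_ge m c : (n <= c)%N -> psum m c = mdeg m.
Proof.
move=> le_n; rewrite mdegE /psum; apply: eq_bigl => i.
exact: leq_trans (ltn_ord i) le_n.
Qed.

Lemma psum_minn m c : psum m c = psum m (minn c n).
Proof. by case: (leqP c n) => // /ltnW h; rewrite !psum_ge. Qed.

Lemma psumS m (i : 'I_n) : psum m i.+1 = (psum m i + m i)%N.
Proof.
rewrite /psum (bigD1 i) //= addnC; congr (_ + _)%N; apply: eq_bigl => j.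
by rewrite -val_eqE /=; lia.
Qed.

Lemma psum_le m c c' : (c <= c')%N -> (psum m c <= psum m c')%N.
Proof.
move=> le_c; rewrite /psum [X in (_ <= X)%N](bigID (fun i : 'I_n => (i < c)%N)) /=.
apply: leq_trans (leq_addr _ _); apply/eq_leq/eq_bigl => i; lia.
Qed.

Lemma psum_const m a c : (a <= c)%N ->
  (forall i : 'I_n, (a <= i < c)%N -> m i = 0%N) -> psum m c = psum m a.
Proof.
move=> le_ac h; rewrite /psum (bigID (fun i : 'I_n => (i < a)%N)) /=.
rewrite [X in (_ + X)%N]big1 ?addn0; first by apply: eq_bigl => i; lia.
by move=> i hi; apply: h; lia.
Qed.

Lemma psum_inj m p : (forall c, psum m c = psum p c) -> m = p.
Proof.
move=> h; apply/mnmP=> i; have := h i.+1; rewrite !psumS h.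
exact: addnI.
Qed.

Lemma psum_diff (F : nat -> nat) : F 0 = 0%N -> {homo F : x y / (x <= y)%N} ->
  forall c, psum [multinom (F i.+1 - F i)%N | i < n] c = F (minn c n).
Proof.
move=> F0 Fm c; rewrite psum_minn; have := geq_minr c n; set k := minn _ _.
elim: k => [|k IH] le_k; first by rewrite psum0.
rewrite (psumS _ (Ordinal le_k)) /= IH 1?ltnW // mnmE /=.
by rewrite subnKC // Fm.
Qed.

Lemma psumB m p c : (p <= m)%MM -> psum (m - p)%MM c = (psum m c - psum p c)%N.
Proof. by move=> /submK {2}<-; rewrite psumD addnK. Qed.

End PartialSums.

(** * The generators of [Bt] in terms of partial sums *)

Section Spread.
Variables (n t : nat) (t_gt0 : (1 <= t)%N).
Implicit Types u v m : 'X_{1..n}.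

(** A window of [t] consecutive variables meets at most one factor of [m], counted with
    multiplicity; since [t] is positive, this also makes [m] squarefree. *)
Lemma t_spread_psum m :
  t_spread t m <-> forall c, (psum m (c + t) <= (psum m c).+1)%N.
Proof.
split=> [[s hs ->] c|h].
  have E c' : psum (\sum_(i <- s) U_(i))%MM c' = count (fun i : 'I_n => (i < c')%N) s.
    elim: (s) => [|a r IH]; first by rewrite big_nil psum_mnm0.
    by rewrite big_cons psumD IH psum_mnm1.
  rewrite !E; elim: s hs {E} => //= a s IH hs.
  have tr : transitive (fun i j : 'I_n => (i + t <= j)%N) by move=> ? ? ? /=; lia.
  have /allP ha := order_path_min tr hs.
  have := IH (path_sorted hs).
  case: (ltnP a c) => hac; case: (ltnP a (c + t)) => hact; rewrite ?add0n //; try lia.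
  move=> _; suff -> : count (fun i : 'I_n => (i < c + t)%N) s = 0%N by [].
  by apply/eqP; rewrite -leqn0 leqNgt -has_count; apply/hasPn => j /ha; lia.
exists [seq i <- enum 'I_n | m i != 0%N]; last first.
  apply/mnmP=> i; rewrite mnm_sumE.
  rewrite big_filter big_enum_cond /= (bigID (pred1 i)) /= [X in (_ + X)%N]big1; last first.
    by move=> j /andP[_ ne]; rewrite mnm1E (negPf ne).
  rewrite addn0; have le1 : (m i <= 1)%N.
    have := h i; have := psumS m i; have := @psum_le _ m i.+1 (i + t); lia.
  rewrite (eq_bigl (fun j => (j == i) && (m i != 0%N))); last first.
    by move=> j; rewrite andbC; case: eqP => // ->.
  case: (m i) le1 => [|[|//]] _; first by rewrite big_pred0 // => j; rewrite andbF.
  by rewrite (big_pred1 i) ?mnm1E ?eqxx // => j; rewrite andbT.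
have srt : sorted (fun i j : 'I_n => (i < j)%N) (enum 'I_n).
  have := iota_ltn_sorted 0 n; rewrite -val_enum_ord sorted_map.
  by apply: sub_sorted => i j.
have tr : transitive (fun i j : 'I_n => (i < j)%N) by move=> ? ? ? /=; lia.
have : sorted (fun i j : 'I_n => (i < j)%N) [seq i <- enum 'I_n | m i != 0%N].
  exact: sorted_filter.
apply: sub_in_sorted (_ : all (fun i => m i != 0%N) _); last exact: filter_all.
move=> i j mi mj lt_ij; rewrite leqNgt; apply/negP => gt_j.
have := h i; have := psumS m i; have := psumS m j.
have := @psum_le _ m i.+1 j lt_ij; have := @psum_le _ m j.+1 (i + t) gt_j.
lia.
Qed.

Lemma borel_trans u v w : borel t u v -> borel t v w -> borel t u w.
Proof. by move=> huv; elim=> // {}w j i _ IH wj lt_ij hw; apply: borel_step. Qed.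

(** For the converse, at the first index [i] where [u] and [v] differ, [v] has a variable and [u]
    has none. Moving the next variable of [u] down to [i] keeps [u] spread and its partial sums
    below those of [v], and shrinks the total gap. *)
Lemma borel_psum u v : t_spread t u -> borel t u v <->
  [/\ t_spread t v, mdeg v = mdeg u & forall c, (psum u c <= psum v c)%N].
Proof.
move=> tu; split=> [bv|].
  split; [by case: bv | exact: borel_mdeg bv|].
  elim: bv => // {}v j i _ IH vj lt_ij _ c; apply: leq_trans (IH c) _.
  have le_j : (U_(j) <= v)%MM by rewrite lep1mP.
  rewrite psumD psumB // !psum_mnm1.
  have : (psum U_(j)%MM c <= psum v c)%N by rewrite -(submK le_j) psumD leq_addl.
  rewrite psum_mnm1; lia.
case=> tv; have [N] := ubnP (\sum_(c < n.+1) (psum v c - psum u c)).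
elim: N u tu => // N IH u tu leN ed le_uv.
have [/eqP ->|ne_uv] := boolP (u == v); first exact: borel_refl.
have /t_spread_psum wu := tu; have /t_spread_psum wv := tv.
have [i0 ne_i0] : exists i, v i != u i.
  apply/existsP; rewrite -negb_forall; apply: contra ne_uv => /forallP h.
  by apply/eqP/mnmP => i; rewrite (eqP (h i)).
have [i ne_i eq_i] : exists2 i, v i != u i &
    forall j : 'I_n, (j < i)%N -> v j = u j.
  exists [arg min_(i < i0 | v i != u i) (i : nat)]; first by case: arg_minnP.
  case: arg_minnP => // i _ hmin j; apply: contraTeq => /hmin; rewrite -leqNgt.
  exact.
have eqp c : (c <= i)%N -> psum u c = psum v c.
  by move=> le_c; apply: eq_bigr => j lt_j; rewrite eq_i // (leq_trans lt_j).
have pi := eqp i (leqnn i); have pu := psumS u i; have pv := psumS v i.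
have vi1 := wv i; have vi2 := @psum_le _ v i.+1 (i + t).
have lei := le_uv i.+1.
have [ui vi] : u i = 0%N /\ v i = 1%N by lia.
have [j0 /andP[lt_ij0 uj0]] : exists j : 'I_n, (i < j)%N && (u j != 0%N).
  apply/existsP; apply: contraT; rewrite negb_exists => /forallP h.
  have := @psum_const _ u i.+1 n (ltn_ord i).
  rewrite psum_ge // -ed -(psum_ge v (leqnn n)) => hn.
  have : psum v n = psum u i.+1.
    by apply: hn => l /andP[hl _]; have := h l; rewrite hl negbK => /eqP.
  have := psum_le v (ltn_ord i); lia.
have [j [lt_ij uj] eq_j] : exists2 j : 'I_n, (i < j)%N /\ u j != 0%N &
    forall l : 'I_n, (i.+1 <= l < j)%N -> u l = 0%N.
  exists [arg min_(j < j0 | (i < j)%N && (u j != 0%N)) (j : nat)].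
    by case: arg_minnP; rewrite ?lt_ij0 // => j /andP[].
  case: arg_minnP; rewrite ?lt_ij0 // => j _ hmin l /andP[il lj].
  apply/eqP; apply: contraTT lj => ul; rewrite -leqNgt; apply: hmin.
  by rewrite il.
have puc c : (i < c)%N -> (c <= j)%N -> psum u c = psum u i.+1.
  move=> ic cj; apply: psum_const => // l hl; apply: eq_j; lia.
have le_j : (U_(j) <= u)%MM by rewrite lep1mP.
pose u' := (u - U_(j) + U_(i))%MM.
have pu' c : psum u' c = (psum u c - (j < c) + (i < c))%N.
  by rewrite psumD psumB // !psum_mnm1.
have puj c : (j < c)%N -> (0 < psum u c)%N.
  by move=> jc; rewrite -(submK le_j) psumD psum_mnm1 jc addn1.
have tu' : t_spread t u'.
  apply/t_spread_psum => c; rewrite !pu'.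
  have := wu c; have := wv c; have := eqp c; have := puc (c + t)%N.
  have := puj c; have := puj (c + t)%N; have := @psum_le _ v i.+1 (c + t).
  lia.
apply: (@borel_trans _ u'); first by apply: borel_step => //; apply: borel_refl.
apply: IH => //.
- apply: leq_trans (leN : (_ <= N)%N).
  have hi : (i.+1 < n.+1)%N by rewrite ltnS.
  rewrite (bigD1 (Ordinal hi)) //= [X in (_ <= X)%N](bigD1 (Ordinal hi)) //=.
  rewrite -addSn leq_add //; first by rewrite pu'; lia.
  apply: leq_sum => c _; rewrite leq_sub2l // pu'.
  have := puj c; lia.
- have : (mdeg u' + mdeg U_(j) = mdeg u + mdeg U_(i))%N.
    by rewrite -!mdegD -addmA [(U_(i) + _)%MM]addmC addmA submK.
  by rewrite !mdeg1 ed; lia.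
- move=> c; rewrite pu'; have := le_uv c; have := puc c.
  have := @psum_le _ v i.+1 c; have := puj c; lia.
Qed.


End Spread.

(** Monomials reached by Borel moves share one degree, so none properly divides another. *)
Lemma min_monomial_gen_borel (K : fieldType) (n t : nat) (u v : 'X_{1..n}) :
    (1 <= t)%N -> t_spread t u ->
  min_monomial_gen (@Bt K n t u) v <-> borel t u v.
Proof.
move=> t1 hu.
have BtX m : @Bt K n t u 'X_[m] <-> exists2 w, borel t u w & (w <= m)%MM.
  rewrite Bt_borel // monomial_idealP; split=> [/(_ m)|h p].
    by rewrite msuppX mem_head => /(_ isT).
  by rewrite msuppX inE => /eqP ->.
split=> [[/BtX[w bw le_w] hmin]|bv].
  suff <- : w = v by [].
  by apply: hmin => //; apply/BtX; exists w; rewrite ?lepm_refl.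
split=> [|m /BtX[w bw le_w] le_m]; first by apply/BtX; exists v; rewrite ?lepm_refl.
have ewv : mdeg w = mdeg v by rewrite (borel_mdeg bw) (borel_mdeg bv).
have : mdeg (v - m)%MM = 0%N.
  have := congr1 mdeg (submK le_w); have := congr1 mdeg (submK le_m).
  by rewrite !mdegD; lia.
by move/eqP; rewrite mdeg_eq0 => /eqP e0; rewrite -(submK le_m) e0 add0m.
Qed.

(* [sq_bound m] is the line through (m, m^2) and (m + 1, (m + 1)^2), summed   *)
(* over k arguments with sum z; the least sum of squares of k integers with   *)
(* sum z is the maximum of these bounds over m.                               *)
Definition sq_bound (m k z : int) : int := (2 * m + 1) * z - k * m * (m + 1).

Definition min_sq (k z : int) : int := sq_bound (z %/ k)%Z k z.

Lemma sq_bound_max (a f k z : int) : 0 <= k -> f * k <= z -> z <= (f + 1) * k ->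
  sq_bound a k z <= sq_bound f k z.
Proof.
move=> k0 h1 h2; rewrite -subr_ge0.
have -> : sq_bound f k z - sq_bound a k z = (f - a) * (2 * z - k * (f + a + 1)).
  by rewrite /sq_bound; ring.
have [le_af|lt_fa] := lerP (a + 1) f; first by apply: mulr_ge0; nia.
have [->|ne] := eqVneq f a; first by rewrite subrr mul0r.
by apply: mulr_le0; nia.
Qed.

(** The right end [z = (f + 1) * k] is included: neighbouring lines meet there, and [min_sq_split]
    uses that end. *)
Lemma min_sqE (f k z : int) : 0 <= k -> f * k <= z -> z <= (f + 1) * k ->
  min_sq k z = sq_bound f k z.
Proof.
move=> k0 h1 h2; apply/eqP; rewrite eq_le sq_bound_max //=.
have [ek|k_gt0] : k = 0 \/ 0 < k by lia.
  by rewrite /sq_bound ek; have -> : z = 0 by [lia]; rewrite !mulr0 !mul0r.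
have hdiv := divz_eq z k; have := modz_ge0 z (lt0r_neq0 k_gt0).
have := ltz_pmod z k_gt0; move=> ? ?.
by apply: sq_bound_max; lia.
Qed.

Lemma sq_bound_le (a k z : int) : 0 <= k -> (k = 0 -> z = 0) ->
  sq_bound a k z <= min_sq k z.
Proof.
move=> k0 hz.
have [ek|k_gt0] : k = 0 \/ 0 < k by lia.
  by rewrite /min_sq /sq_bound ek hz // !mulr0 !mul0r.
have hdiv := divz_eq z k; have := modz_ge0 z (lt0r_neq0 k_gt0).
have := ltz_pmod z k_gt0; move=> ? ?.
by apply: sq_bound_max; lia.
Qed.

Lemma sq_boundD a k l z y :
  sq_bound a (k + l) (z + y) = sq_bound a k z + sq_bound a l y.
Proof. by rewrite /sq_bound; ring. Qed.

(** The line attaining the minimum for the sum bounds both summands from below. *)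
Lemma min_sqD (k l z y : int) : 0 <= k -> 0 <= l ->
    (k = 0 -> z = 0) -> (l = 0 -> y = 0) ->
  min_sq (k + l) (z + y) <= min_sq k z + min_sq l y.
Proof.
by move=> *; rewrite {1}/min_sq sq_boundD lerD // sq_bound_le.
Qed.

Lemma min_sq1 z : min_sq 1 z = z * z.
Proof. by rewrite /min_sq divz1 /sq_bound; ring. Qed.

Lemma min_sq_ge0 (k z : int) : 0 <= k -> (k = 0 -> z = 0) -> 0 <= min_sq k z.
Proof.
move=> k0 hz; have := @sq_bound_le 0 k z k0 hz; have := @sq_bound_le (-1) k z k0 hz.
by rewrite /sq_bound; lia.
Qed.

(* A part x with |z - k x| < k is the floor or the ceiling of z / k, and can  *)
(* therefore be split off from a balanced decomposition of z.                 *)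
Lemma min_sq_split (k z x : int) : 0 <= k ->
    z < (k + 1) * (x + 1) -> (k + 1) * (x - 1) < z ->
  min_sq (1 + k) (x + (z - x)) = min_sq 1 x + min_sq k (z - x).
Proof.
move=> k0 h1 h2.
have [h|h] := lerP (x * (k + 1)) z.
  by rewrite !(@min_sqE x) ?sq_boundD; nia.
by rewrite !(@min_sqE (x - 1)) ?sq_boundD; nia.
Qed.

(** Two integers at distance at least 2 are not a balanced decomposition of their sum. *)
Lemma min_sq_gap (x y : int) : y + 2 <= x ->
  min_sq (1 + 1) (x + y) < min_sq 1 x + min_sq 1 y.
Proof.
rewrite {1}/min_sq sq_boundD !min_sq1; set a := (_ %/ _)%Z => h.
rewrite -subr_gt0.
have -> : x * x + y * y - (sq_bound a 1 x + sq_bound a 1 y) =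
  (x - a) * (x - a - 1) + (y - a) * (y - a - 1) by rewrite /sq_bound; ring.
have sq (z : int) : 0 <= (z - a) * (z - a - 1).
  have [|] := lerP (a + 1) z; nia.
have sx := sq x; have sy := sq y.
have [lt_ya|le_ay] := ltrP y a.
  have : 0 < (y - a) * (y - a - 1) by nia.
  by lia.
have : 0 < (x - a) * (x - a - 1) by nia.
by lia.
Qed.

Lemma forall_ord_minn (n : nat) (P : nat -> bool) :
  (forall c, P c = P (minn c n)) ->
  reflect (forall c, P c) [forall c : 'I_n.+1, P c].
Proof.
move=> hP; apply: (iffP forallP) => [h c|h c]; last exact: h.
have hc : (minn c n < n.+1)%N by rewrite ltnS geq_minr.
by rewrite hP; apply: (h (Ordinal hc)).
Qed.

(** * Lattice points of [k P] and their sorted factorizations *)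

Section Layers.

Variables (n t : nat) (u : 'X_{1..n}).
Local Notation d := (mdeg u).

Definition layer (k : nat) (m : 'X_{1..n}) : bool :=
  [&& mdeg m == (k * d)%N,
      [forall c : 'I_n.+1, (psum m (c + t) <= psum m c + k)%N] &
      [forall c : 'I_n.+1, (k * psum u c <= psum m c)%N]].

Lemma layerP k m : reflect
  [/\ mdeg m = (k * d)%N, forall c, (psum m (c + t) <= psum m c + k)%N &
      forall c, (k * psum u c <= psum m c)%N] (layer k m).
Proof.
apply: (iffP and3P) => -[/eqP h1 h2 h3]; split=> //.
- apply/forall_ord_minn: h2 => c; rewrite -psum_minn; congr (_ <= _)%N.
  rewrite [LHS]psum_minn [RHS]psum_minn; congr (psum m _); lia.
- by apply/forall_ord_minn: h3 => c; rewrite -!psum_minn.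
- exact/forallP.
- exact/forallP.
Qed.

Lemma layer0 m : layer 0 m <-> m = 0%MM.
Proof.
split=> [/layerP[/eqP]|->]; first by rewrite mul0n mdeg_eq0 => /eqP.
by apply/layerP; split=> [|c|c]; rewrite ?mdeg0 ?mul0n // !psum_mnm0.
Qed.

Lemma layerD k l m p : layer k m -> layer l p -> layer (k + l) (m + p)%MM.
Proof.
move=> /layerP[m1 m2 m3] /layerP[p1 p2 p3]; apply/layerP; split=> [|c|c].
- by rewrite mdegD m1 p1 mulnDl.
- by rewrite !psumD addnACA leq_add.
- by rewrite psumD mulnDl leq_add.
Qed.

Lemma layer1_borel m : (1 <= t)%N -> t_spread t u -> layer 1 m <-> borel t u m.
Proof.
move=> t_gt0 hu.
split=> [/layerP[h1 h2 h3]|/(borel_psum t_gt0 _ hu)[/(t_spread_psum t_gt0) h2 h1 h3]].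
  apply/(borel_psum t_gt0 _ hu); split=> [||c]; last 1 first.
  - by have := h3 c; rewrite mul1n.
  - by apply/(t_spread_psum t_gt0) => c; rewrite -addn1.
  - by rewrite h1 mul1n.
by apply/layerP; split=> [|c|c]; rewrite ?mul1n ?addn1.
Qed.

(** Equivalently, one of [x], [y] has as partial sums the floors, and the other the ceilings, of
    half the partial sums of their product. *)
Definition sortable (x y : 'X_{1..n}) : bool :=
  [forall i : 'I_n.+1, [forall j : 'I_n.+1,
    (psum x i + psum y j <= psum x j + psum y i + 1)%N]].

Lemma sortableP x y : reflect
  (forall i j, (psum x i + psum y j <= psum x j + psum y i + 1)%N)
  (sortable x y).
Proof.
apply: (iffP forallP) => [h i j|h i]; last by apply/forallP => j; apply: h.
have hi : (minn i n < n.+1)%N by rewrite ltnS geq_minr.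
have hj : (minn j n < n.+1)%N by rewrite ltnS geq_minr.
have /forallP/(_ (Ordinal hj)) := h (Ordinal hi).
by rewrite /= -!psum_minn.
Qed.

Lemma sortableC x y : sortable x y = sortable y x.
Proof.
by apply/sortableP/sortableP => h i j; have := h j i; lia.
Qed.

(** The bounds defining [layer] are integer multiples of the degree, so they survive division and
    rounding; [s <= k] keeps the first and the last partial sum exact. *)
Lemma layer_floor k m s : layer k.+1 m -> (s <= k)%N -> exists2 x, layer 1 x &
  forall c, psum x c = ((psum m c + s) %/ k.+1)%N.
Proof.
move=> /layerP[m1 m2 m3] le_s.
pose F c := ((psum m c + s) %/ k.+1)%N.
have F0 : F 0%N = 0%N by rewrite /F psum0 divn_small.
have Fm : {homo F : x y / (x <= y)%N}.
  by move=> x y le_xy; rewrite leq_div2r // leq_add2r psum_le.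
pose x := [multinom (F i.+1 - F i)%N | i < n].
have Ex c : psum x c = F c by rewrite /x psum_diff // /F -psum_minn.
exists x => //; apply/layerP; split=> [|c|c].
- rewrite -(psum_ge x (leqnn n)) Ex /F psum_ge // m1 mul1n mulnC divnMDl //.
  by rewrite divn_small // addn0.
- rewrite !Ex /F -[1%N](@divnn k.+1) -divnDr // leq_div2r //.
  by have := m2 c; lia.
- by rewrite mul1n Ex leq_divRL // mulnC (leq_trans (m3 c)) // leq_addr.
Qed.

Hypothesis d_gt0 : (0 < d)%N.

Definition rank (m : 'X_{1..n}) : nat := mdeg m %/ d.

Lemma layer_rank k m : layer k m -> rank m = k.
Proof. by case/layerP=> e _ _; rewrite /rank e mulnK. Qed.

(* For m of degree k, this says that all differences of partial sums satisfy  *)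
(* |(m_i - m_j) - k (x_i - x_j)| < k: the generator x occurs in the sorted    *)
(* factorization of m.                                                        *)
Definition factor (x m : 'X_{1..n}) : bool :=
  [forall i : 'I_n.+1, [forall j : 'I_n.+1,
    (psum m i + rank m * psum x j < psum m j + rank m * psum x i + rank m)%N]].

Lemma factorP k x m : layer k m -> reflect
  (forall i j, (psum m i + k * psum x j < psum m j + k * psum x i + k)%N)
  (factor x m).
Proof.
move=> /layer_rank <-; rewrite /factor.
apply: (iffP forallP) => [h i j|h i]; last by apply/forallP => j; apply: h.
have hi : (minn i n < n.+1)%N by rewrite ltnS geq_minr.
have hj : (minn j n < n.+1)%N by rewrite ltnS geq_minr.
have /forallP/(_ (Ordinal hj)) := h (Ordinal hi).
by rewrite /= -!psum_minn.
Qed.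

Lemma layer_factor_ex k m : layer k.+1 m -> exists2 x, layer 1 x & factor x m.
Proof.
move=> Lm; have [x Lx ex] := layer_floor Lm (leq0n k); exists x => //.
apply/(factorP x Lm) => i j; rewrite !ex !addn0.
have := divn_eq (psum m i) k.+1; have := ltn_pmod (psum m i) (ltn0Sn k).
have := divn_eq (psum m j) k.+1; lia.
Qed.

(* Rounding with a shift s that makes m_i + s divisible by k yields a factor  *)
(* whose difference x_i - x_j is the ceiling of (m_i - m_j) / k.              *)
Lemma layer_factor_ceil k m i j : layer k.+1 m -> exists x, [/\ layer 1 x,
  factor x m & (psum m i + k.+1 * psum x j <= psum m j + k.+1 * psum x i)%N].
Proof.
(* Since [k] is -1 modulo [k.+1], this is the residue of [- psum m i]. *)
move=> Lm; pose s := ((psum m i * k) %% k.+1)%N.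
have le_s : (s <= k)%N by rewrite -ltnS ltn_pmod.
have [x Lx ex] := layer_floor Lm le_s; exists x; split=> //.
  apply/(factorP x Lm) => a c; rewrite !ex.
  have := divn_eq (psum m a + s) k.+1; have := ltn_pmod (psum m a + s) (ltn0Sn k).
  have := divn_eq (psum m c + s) k.+1; lia.
rewrite !ex; have := divn_eq (psum m j + s) k.+1.
have : (k.+1 %| psum m i + s)%N.
  by rewrite /dvdn modnDmr -[X in (X + _)%N]muln1 -mulnDr add1n modnMl.
move=> /divnK; lia.
Qed.

(** Differences of partial sums of [x] are floors or ceilings of those of [m] divided by [k], so
    removing [x] leaves a quotient within the integer bounds one degree lower. *)
Lemma layer_factor_sub k m x : layer k m -> layer 1 x -> factor x m ->
  exists k' p, [/\ k = k'.+1, m = (x + p)%MM & layer k' p].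
Proof.
move=> Lm /layerP[x1 x2 x3] /(factorP x Lm) hf.
case: k Lm hf => [|k] /layerP[m1 m2 m3] hf; first by have := hf 0%N 0%N; lia.
have le_xm : (x <= m)%MM.
  apply/mnm_lepP => i; have := hf i i.+1; rewrite !psumS; nia.
exists k, (m - x)%MM; split=> //; first by rewrite addmC submK.
apply/layerP; split=> [|c|c].
- have := congr1 mdeg (submK le_xm); rewrite mdegD m1 x1; lia.
- rewrite !psumB //; have := hf c (c + t)%N; have := hf (c + t)%N c.
  have := m2 c; have := @psum_le _ x c (c + t) (leq_addr _ _).
  have : (psum x (c + t) <= psum m (c + t))%N.
    by rewrite -(submK le_xm) psumD leq_addl.
  have : (psum x c <= psum m c)%N by rewrite -(submK le_xm) psumD leq_addl.
  nia.
- rewrite psumB //; have := hf 0%N c; have := hf c 0%N; rewrite !psum0.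
  have := m3 c; have := x3 c.
  have : (psum x c <= psum m c)%N by rewrite -(submK le_xm) psumD leq_addl.
  nia.
Qed.

(** A pair [i], [j] at which [y] fails for [p] forces [x] and [y] to have the same difference there,
    and [p] to have the largest one that [x] allows. Any third coordinate [c] is then squeezed
    between [i] and [j], so all differences of [x] and [y] agree. *)
Lemma factor_cancel k p x y : layer 1 x -> layer 1 y -> layer k p ->
  factor x (x + p)%MM -> factor y (x + p)%MM -> y = x \/ factor y p.
Proof.
move=> Lx Ly Lp; have Lm := layerD Lx Lp; rewrite add1n in Lm.
move=> /(factorP x Lm) fx /(factorP y Lm) fy.
have [/(factorP y Lp)|] := boolP (factor y p); [by right | ].
move=> /forallPn[i /forallPn[j]]; rewrite (layer_rank Lp) -leqNgt => hij.
left; have {}fx a e := fx a e; have {}fy a e := fy a e.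
have e_ij : (psum y i + psum x j = psum y j + psum x i)%N.
  have := fx i j; have := fy i j; have := fy j i; rewrite !psumD.
  case: k Lp {Lm fx fy} hij => [|k] Lp; last by nia.
  by move/layer0: Lp => ->; rewrite !psum_mnm0; lia.
have e_i c : (psum y c + psum x i = psum x c + psum y i)%N.
  have := fx i c; have := fx c j; have := fy i c; have := fy c j; rewrite !psumD.
  move=> y1 y2 x1 x2; apply/eqP; rewrite eqn_leq; apply/andP; split; nia.
apply: psum_inj => c; have := e_i c; have := e_i 0%N; rewrite !psum0; lia.
Qed.


(** Multiplied by [k], a difference of [x] is off from that of [p] by at most [k], one of [y] by at
    most [k - 1]; hence [x] and [y] disagree by less than 2. *)
Lemma factor_mul k p x y : layer 1 x -> layer k p ->
  factor x (x + p)%MM -> factor y p -> sortable x y /\ factor y (x + p)%MM.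
Proof.
move=> Lx Lp; have Lm := layerD Lx Lp; rewrite add1n in Lm.
move=> /(factorP x Lm) fx /(factorP y Lp) fy.
have hs i j : (psum x i + psum y j <= psum x j + psum y i + 1)%N.
  have := fx j i; have := fy i j; rewrite !psumD; nia.
split; first exact/sortableP.
apply/(factorP y Lm) => i j; have := hs i j; have := fy i j; rewrite !psumD; nia.
Qed.

(** The flag property. For each pair [i], [j], sortability with a factor whose difference is the
    rounded-up average of that of [p] bounds the difference of [x]. *)
Lemma factor_sortable k p x : layer 1 x -> layer k p ->
  (forall y, layer 1 y -> factor y p -> sortable x y) -> factor x (x + p)%MM.
Proof.
move=> Lx Lp h; have Lm := layerD Lx Lp; rewrite add1n in Lm.
apply/(factorP x Lm) => i j; rewrite !psumD.
case: k Lp {Lm} => [|k] Lp.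
  by move/layer0: Lp => ->; rewrite !psum_mnm0; lia.
have [y [Ly /(h y Ly)/sortableP/(_ j i) hs hc]] := layer_factor_ceil i j Lp.
nia.
Qed.

End Layers.

(** * The weight, and the letters of the toric ring *)

Section Weights.

Variables (n t : nat) (u : 'X_{1..n}).
Hypothesis d_gt0 : (0 < mdeg u)%N.
Local Notation layer := (layer t u).
Local Notation factor := (factor u).
Local Notation rank := (rank u).

Definition pdiff (m : 'X_{1..n}) (i j : nat) : int := (psum m i)%:Z - (psum m j)%:Z.

Lemma pdiffD m p i j : pdiff (m + p)%MM i j = pdiff m i j + pdiff p i j.
Proof. by rewrite /pdiff !psumD; lia. Qed.

(** Each pair contributes the least sum of squares of [k] integers adding up to its difference; a
    sorted factorization attains all these minima at once. *)
Definition energy (k : nat) (m : 'X_{1..n}) : int :=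
  \sum_(i < n.+1) \sum_(j < n.+1) min_sq k (pdiff m i j).

Definition weight (m : 'X_{1..n}) : nat := `|energy (rank m) m|%N.

Lemma layer_pdiff0 k m i j : layer k m -> k%:Z = 0 -> pdiff m i j = 0.
Proof.
by move=> Lm [ek]; move: Lm; rewrite ek => /layer0 ->; rewrite /pdiff !psum_mnm0.
Qed.

Lemma weightE k m : layer k m -> (weight m)%:Z = energy k m.
Proof.
move=> Lm; rewrite /weight (layer_rank d_gt0 Lm) gez0_abs //.
apply: sumr_ge0 => i _; apply: sumr_ge0 => j _; apply: min_sq_ge0 => //.
exact: layer_pdiff0 Lm.
Qed.

Lemma weightD k l m p : layer k m -> layer l p ->
  (weight (m + p)%MM <= weight m + weight p)%N.
Proof.
move=> Lm Lp; rewrite -lez_nat PoszD (weightE Lm) (weightE Lp).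
rewrite (weightE (layerD Lm Lp)) /energy -big_split ler_sum // => i _.
rewrite -big_split ler_sum // => j _; rewrite pdiffD PoszD min_sqD //.
  exact: layer_pdiff0 Lm.
exact: layer_pdiff0 Lp.
Qed.

Lemma weight_factor k x p : layer 1 x -> layer k p -> factor x (x + p)%MM ->
  weight (x + p)%MM = (weight x + weight p)%N.
Proof.
move=> Lx Lp; have Lm := layerD Lx Lp => /(factorP d_gt0 x Lm) hf.
apply/eqP; rewrite -eqz_nat PoszD (weightE Lm) (weightE Lx) (weightE Lp).
apply/eqP; rewrite /energy -big_split; apply: eq_bigr => i _ /=.
rewrite -big_split; apply: eq_bigr => j _ /=; rewrite pdiffD PoszD.
rewrite -[pdiff p i j](addKr (pdiff x i j)) [- _ + _]addrC.
have := hf i j; have := hf j i; rewrite !psumD => h1 h2.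
by rewrite min_sq_split // /pdiff; nia.
Qed.

Lemma weight_unsortable x y : layer 1 x -> layer 1 y -> ~~ sortable x y ->
  (weight (x + y)%MM < weight x + weight y)%N.
Proof.
move=> Lx Ly /forallPn[i /forallPn[j]]; rewrite -ltnNge => hij.
have term a c : min_sq (1 + 1)%N (pdiff (x + y) a c)
    <= min_sq 1 (pdiff x a c) + min_sq 1 (pdiff y a c).
  by rewrite pdiffD PoszD min_sqD.
rewrite -ltz_nat PoszD (weightE Lx) (weightE Ly) (weightE (layerD Lx Ly)).
rewrite /energy -big_split /= (bigD1 i) // [ltRHS](bigD1 i) //=.
apply: ltr_leD; last first.
  apply: ler_sum => a _; rewrite -big_split ler_sum // => c _; exact: term.
rewrite -big_split /= (bigD1 j) // [ltRHS](bigD1 j) //=.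
apply: ltr_leD; last by apply: ler_sum => c _; apply: term.
by rewrite pdiffD PoszD min_sq_gap // /pdiff; lia.
Qed.

Definition gens : seq 'X_{1..n} :=
  [seq m : 'X_{1..n} <- [seq val m | m <- enum {: 'X_{1..n < (mdeg u).+1}}] |
     layer 1 m].

Lemma gens_uniq : uniq gens.
Proof. by rewrite filter_uniq // map_inj_uniq ?enum_uniq //; apply: val_inj. Qed.

Lemma mem_gens m : (m \in gens) = layer 1 m.
Proof.
rewrite mem_filter; case Lm: (layer 1 m) => //=.
have /layerP[e _ _] := Lm; have lt_m : (mdeg m < (mdeg u).+1)%N by rewrite e mul1n.
by apply/mapP; exists (BMultinom lt_m); rewrite ?mem_enum.
Qed.

Definition gen (b : 'I_(size gens)) : 'X_{1..n} := tnth (in_tuple gens) b.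

Lemma gen_layer b : layer 1 (gen b).
Proof. by rewrite -mem_gens mem_tnth. Qed.

Lemma gen_surj x : layer 1 x -> exists b, gen b = x.
Proof. by rewrite -mem_gens => /(@tnthP _ _ (in_tuple gens))[b ->]; exists b. Qed.

Lemma gen_inj : injective gen.
Proof. by apply/tuple_uniqP; apply: gens_uniq. Qed.

Lemma layer_letters : letter_axioms layer gen (fun b => factor (gen b))
  (fun b c => sortable (gen b) (gen c)) weight.
Proof.
split.
- exact: layer0.
- by move=> k l m p; apply: layerD.
- exact: gen_layer.
- exact: gen_inj.
- by move=> b c; apply: sortableC.
- move=> k m /(layer_factor_ex d_gt0)[x /gen_surj[b <-]]; by exists b.
- move=> k m b Lm hb; have Lb := gen_layer b.
  have [k' [p [ek em Lp]]] := layer_factor_sub d_gt0 Lm Lb hb.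
  by exists k', p; split=> //; rewrite em (weight_factor Lb Lp) -?em.
- move=> k p b c Lp hb hc.
  have [/gen_inj|] := factor_cancel d_gt0 (gen_layer b) (gen_layer c) Lp hb hc; by [left | right].
- move=> k p b c Lp hb hc; exact: (factor_mul d_gt0 (gen_layer b) Lp hb hc).
- move=> k p b Lp h; apply: (factor_sortable d_gt0 (gen_layer b) Lp).
  by move=> y /gen_surj[c <-]; apply: h.
- by move=> k l m p; apply: weightD.
- by move=> b c; apply: weight_unsortable; apply: gen_layer.
Qed.

End Weights.

(** * The monomials of the toric ring, and the conclusion *)

(** The induction principle among the hypotheses says that [L] is no larger than the monoid
    generated by [G]. *)
Lemma subalg_gen_monomialsP (K : fieldType) (n : nat) (G L : 'X_{1..n} -> Prop) :
    L 0%MM -> (forall m p, L m -> L p -> L (m + p)%MM) -> (forall v, G v -> L v) ->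
    (forall P : 'X_{1..n} -> Prop, P 0%MM ->
       (forall v m, G v -> P m -> P (v + m)%MM) -> forall m, L m -> P m) ->
  forall p : {mpoly K[n]},
  subalg_gen (fun q => exists2 v, G v & q = 'X_[v]) p <->
  forall m, m \in msupp p -> L m.
Proof.
move=> L0 LD GL Lind p; split=> [hp|hp R hR hG].
  apply: (hp (fun p => forall m, m \in msupp p -> L m)) => {hp}; last first.
    by move=> _ [v Gv ->] m; rewrite msuppX inE => /eqP ->; apply: GL.
  split=> [m|a x y hx hy m|x y hx hy m].
  - by rewrite msupp1 inE => /eqP ->.
  - by move/msuppD_le; rewrite mem_cat => /orP[/msuppZ_le/hx|/hy].
  - by move/msuppM_le/allpairsP => -[[m1 m2] [/hx h1 /hy h2 ->]]; apply: LD.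
case: hR => R1 RZ RM.
have R0 : R 0 by have := RZ (-1) 1 1 R1 R1; rewrite scaleN1r addNr.
rewrite (mpolyE p) big_seq; elim/big_ind: _ => // [x y hx hy|m /hp Lm].
  by have := RZ 1 x y hx hy; rewrite scale1r.
rewrite -[_ *: _]addr0; apply: RZ => //; move: m Lm; apply: Lind.
  by rewrite mpolyX0.
by move=> v m Gv Rm; rewrite mpolyXD; apply: RM => //; apply: hG; exists v.
Qed.

Theorem corollary3p3 (K : fieldType) (n t : nat) (ht : (1 <= t)%N)
    (u : 'X_{1..n}) (hu : t_spread t u) :
  koszul (@toric K n t u) (@toric_gr K n t u).
Proof.
have [d0|d_gt0] := posnP (mdeg u).
  (* For [u = 1] the algebra is K and [rank] would divide by zero. With no letters at all, only the
     empty word remains and the resolution has length 0. *)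
  pose L (k : nat) (m : 'X_{1..n}) := k = 0%N /\ m = 0%MM.
  have hT (p : {mpoly K[n]}) : toric t u p <-> forall m, m \in msupp p -> exists k, L k m.
    apply: subalg_gen_monomialsP.
    - by exists 0%N.
    - by move=> m r [k [_ ->]] [l [_ ->]]; exists 0%N; rewrite addm0.
    - move=> v /(min_monomial_gen_Bt_mdeg ht hu)/eqP; rewrite d0 mdeg_eq0 => /eqP ->.
      by exists 0%N.
    - by move=> P P0 _ m [k [_ ->]].
  have ax : @letter_axioms n 0 L (fun _ => 0%MM) (fun _ _ => false)
      (fun _ _ => false) (fun _ => 0%N).
    split=> //; try by case.
    - by move=> m; split=> [[]|->].
    - by move=> k l m p [-> ->] [-> ->]; rewrite addm0.
    - by move=> k m [].
    - by move=> k p [[]].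
  apply: (koszul_letters ax hT) => k p.
  split=> [[/hT hp /dhomogP hk] m hm|hp].
    have [l [_ em]] := hp m hm; split=> //.
    have : mdeg m = (k * maxn 1 (mdeg u))%N := hk m hm.
    by rewrite em d0 mdeg0 muln1.
  split; first by apply/hT => m /hp hm; exists k.
  by apply/dhomogP => m /hp[-> ->]; rewrite /= mdeg0 mul0n.
have hT (p : {mpoly K[n]}) : toric t u p <-> forall m, m \in msupp p -> exists k, layer t u k m.
  apply: subalg_gen_monomialsP.
  - by exists 0%N; apply/layer0.
  - by move=> m r [k hk] [l hl]; exists (k + l)%N; apply: layerD.
  - move=> v /(min_monomial_gen_borel _ _ ht hu)/(layer1_borel _ ht hu) hv.
    by exists 1%N.
  - move=> P P0 PD m [k]; elim: k m => [|k IH] m Lm; first by move/layer0: Lm => ->.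
    have [x Lx fx] := layer_factor_ex d_gt0 Lm.
    have [k' [r [[<-] -> Lr]]] := layer_factor_sub d_gt0 Lm Lx fx.
    apply: PD; last exact: IH.
    by apply/(min_monomial_gen_borel _ _ ht hu)/(layer1_borel _ ht hu).
apply: (koszul_letters (layer_letters t d_gt0) hT) => k p.
rewrite /toric_gr (maxn_idPr d_gt0); split=> [[/hT hp /dhomogP hk] m hm|hp].
  have [l Lm] := hp m hm; suff -> : k = l by [].
  have : mdeg m = (k * mdeg u)%N := hk m hm.
  by have /layerP[-> _ _] := Lm => /eqP; rewrite eqn_pmul2r // => /eqP.
split; first by apply/hT => m /hp hm; exists k.
by apply/dhomogP => m /hp/layerP[].
Qed.
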